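(* Let $\mathcal{F}=\{E_1|H_1,\ldots,E_n|H_n\}$ be a p-consistent family of $n$ conditional events and let $E_{n+1}|H_{n+1}$ be a further conditional event. Then the following assertions are equivalent: (i) $\mathcal{F}$ p-entails $E_{n+1}|H_{n+1}$; (ii) the conjunction $\mathcal{C}_{n+1}=(E_1|H_1)\wedge\cdots\wedge(E_n|H_n)\wedge(E_{n+1}|H_{n+1})$ coincides with the conjunction $\mathcal{C}_n=(E_1|H_1)\wedge\cdots\wedge(E_n|H_n)$; (iii) the inequality $\mathcal{C}_n\leq E_{n+1}|H_{n+1}$ is satisfied.
   Context: Events are two-valued propositions (identified with subsets of the sure event $\Omega$, and with their indicators); $\overline{A}$ is negation, $AB$ is conjunction. For events $E,H$ with $H\neq\emptyset$, the conditional event $E|H$ is true if $EH$ is true, false if $\overline{E}H$ is true, void if $\overline{H}$ is true. A conditional random quantity $X|H$ ($X$ with finitely many values, $H\ne\emptyset$) with assessed prevision $\mu=\mathbb{P}(X|H)$ is identified with the random quantity $XH+\mu\overline{H}$; in particular $E|H=EH+x\overline{H}$ with $x=P(E|H)$. Coherence: an assessment of previsions $\mu_j=\mathbb{P}(X_j|K_j)$ on a family of conditional random quantities is coherent if, for every finite subfamily $\{X_1|K_1,\ldots,X_r|K_r\}$ and all real $s_1,\ldots,s_r$, the gain $G=\sum_j s_jK_j(X_j-\mu_j)$ restricted to $K_1\vee\cdots\vee K_r$ satisfies $\min G\leq 0\leq\max G$. Conjunction. For each nonempty $S\subseteq\{1,\ldots,n+1\}$ let $x_S$ be the assessed prevision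 of $\mathcal{C}_S=\bigwedge_{i\in S}(E_i|H_i)$ ($x_{\{i\}}=P(E_i|H_i)$). $\mathcal{C}_S$ is the random quantity, conditional on $\bigvee_{i\in S}H_i$, with value $1$ if all $E_i|H_i$, $i\in S$, are true; $0$ if at least one is false; $x_V$ if none is false and the set $V\subseteq S$ of indices of void ones is nonempty (so its value is its prevision $x_S$ when all $H_i$, $i\in S$, are false). Convention: the numbers $x_S$ always form a coherent assessment on the family of all $\mathcal{C}_S$; the equality in (ii) and the inequality in (iii) are between random quantities (pointwise on $\Omega$) and are meant to hold for every such coherent assessment $(x_S)$. p-consistency: $\mathcal{F}$ is p-consistent if and only if the probability assessment $P(E_1|H_1)=\cdots=P(E_n|H_n)=1$ on $\mathcal{F}$ is coherent. p-entailment: a p-consistent family $\mathcal{F}$ p-entails $E_{n+1}|H_{n+1}$ if and only if for any coherent probability assessment $(p_1,\ldots,p_n,p_{n+1})$ on $\mathcal{F}\cup\{E_{n+1}|H_{n+1}\}$ it holds that: if $p_1=\cdots=p_n=1$, then $p_{n+1}=1$. *)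

(* Defs.v *)
From HB Require Import structures.
From mathcomp Require Import all_boot all_order all_algebra.
From mathcomp Require Import all_classical all_reals all_analysis.
Set Implicit Arguments.
Unset Strict Implicit.
Unset Printing Implicit Defensive.
Import Order.TTheory GRing.Theory Num.Theory.
Local Open Scope classical_set_scope.
Local Open Scope ring_scope.

Definition is_min (R : realType) (A : set R) (m : R) : Prop :=
  A m /\ lbound A m.

Definition is_max (R : realType) (A : set R) (M : R) : Prop :=
  A M /\ ubound A M.

Definition gain (R : realType) (Omega : Type) (I : finType) (J : {set I})
    (X : I -> Omega -> R) (K : I -> set Omega) (mu s : I -> R) (w : Omega) : R :=
  \sum_(j in J) s j * \1_(K j) w * (X j w - mu j).

(* The conditional random quantities X_i|K_i are indexed by i in F and each X_i
   is meant to take finitely many values, so the minimum and the maximum of the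
   gain exist. J is nonempty because otherwise the gain is restricted to the
   impossible event. *)
Definition coherent (R : realType) (Omega : Type) (I : finType) (F : {set I})
    (X : I -> Omega -> R) (K : I -> set Omega) (mu : I -> R) : Prop :=
  forall (J : {set I}) (s : I -> R), J \subset F -> J != finset.set0 ->
    let G := gain J X K mu s @` (\bigcup_(j in [set` J]) K j) in
    exists m M : R, [/\ is_min G m, is_max G M & m <= 0 <= M].

Definition coherent_prob (R : realType) (Omega : Type) (I : finType)
    (F : {set I}) (E H : I -> set Omega) (p : I -> R) : Prop :=
  coherent F (fun i => \1_(E i)) H p.

Definition p_consistent (R : realType) (Omega : Type) (I : finType)
    (F : {set I}) (E H : I -> set Omega) : Prop :=
  coherent_prob F E H (fun=> 1 : R).

Definition p_entails (R : realType) (Omega : Type) (I : finType)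
    (F : {set I}) (k : I) (E H : I -> set Omega) : Prop :=
  forall p : I -> R, coherent_prob (k |: F)%SET E H p ->
    (forall i, i \in F -> p i = 1) -> p k = 1.

(* The conditional event E|H, with P(E|H) = x, as a random quantity. *)
Definition cond_event (R : realType) (Omega : Type) (E H : set Omega) (x : R)
    (w : Omega) : R :=
  \1_(E `&` H) w + x * \1_(~` H) w.

Definition void_set (Omega : Type) (I : finType) (H : I -> set Omega)
    (S : {set I}) (w : Omega) : {set I} :=
  [set i in S | w \notin H i]%SET.

(* x S is the prevision of the conjunction over S. *)
Definition conjunction (R : realType) (Omega : Type) (I : finType)
    (E H : I -> set Omega) (x : {set I} -> R) (S : {set I}) (w : Omega) : R :=
  if [exists i in S, w \in ~` E i `&` H i] then 0
  else if void_set H S w == finset.set0 then 1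
  else x (void_set H S w).

(* Only the values x S with S nonempty matter: no conjunction over a nonempty
   set ever takes the value x set0. *)
Definition coherent_conj (R : realType) (Omega : Type) (I : finType)
    (E H : I -> set Omega) (x : {set I} -> R) : Prop :=
  coherent [set S : {set I} | S != finset.set0]%SET
    (conjunction E H x) (fun S => \bigcup_(i in [set` S]) H i) x.

(* Main.v *)
Require Import Defs.
From HB Require Import structures.
From mathcomp Require Import all_boot all_order all_algebra.
From mathcomp Require Import all_classical all_reals all_analysis.
From mathcomp Require Import lra.
Set Implicit Arguments.
Unset Strict Implicit.
Unset Printing Implicit Defensive.
Import Order.TTheory GRing.Theory Num.Theory.
Local Open Scope classical_set_scope.
Local Open Scope ring_scope.

(** Let [F] be the set of premises, [k] the index of the conclusion, and
negate [E k] to get the family [negate_at k E].  All three assertions are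
equivalent to the same combinatorial condition: for some [S] included in [F],
possibly empty, the quasi conjunction of [S] and of the negated conclusion is
never true (for [S] nonempty, the quasi conjunction of [S] implies the
conclusion in the sense of Goodman and Nguyen).

Suppose that such an [S] exists.  Wherever no premise of [S] is false, the
conclusion is true or everything in [k |: S] is void.  Betting on each
premise of [S] and against the conclusion is then a sure loss when the premises
have probability 1 and the conclusion less, whence p-entailment
([quasi_conj_empty_entails]).  For [V] containing [S], the conjunctions over
[k |: V] and over [V] can differ only through the previsions they take at a
point where [k] and all of [S] are void.  These previsions agree by induction
on the size of [V], since a bet on one conjunction and against the other has a
constant gain ([prevision_absorbs]); so the two conjunctions coincide.  They
are then bounded by the conclusion because a conjunction decreases when
conjuncts are added ([conjunction_anti]).

Suppose that there is no such [S].  By p-consistency of the premises, every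
nonempty subfamily of the premises and the negated conclusion has a true quasi
conjunction somewhere.  At such a point every bet on a conjunction of that
subfamily is void or breaks even, for the explicit assessment in which a
conjunction has prevision 0 or 1 according to whether it involves [k]
([conjunction_negate_at]).  This assessment is therefore coherent.  It
refutes the inequality, and its restriction to single conditional events
refutes p-entailment. *)

(** * Finite sets of values and coherence *)

Lemma finite_set_min (R : realType) (A : set R) :
  finite_set A -> A !=set0 -> exists m, is_min A m.
Proof.
move=> /finite_seqP[s ->]; elim: s => [|a s IHs] A0; first by case: A0.
have [->|s0] := eqVneq s [::].
  by exists a; split=> [/=|b /=]; rewrite inE // => /eqP ->.
have [|m [ms mlb]] := IHs.
  by case: s s0 {IHs A0} => // b s _; exists b; rewrite /= mem_head.
have [am|ma] := leP a m.
- exists a; split=> [|b] /=; first by rewrite mem_head.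
  by rewrite inE => /predU1P[->//|bs]; apply: le_trans am (mlb _ bs).
- exists m; split=> [|b] /=; first by rewrite inE ms orbT.
  by rewrite inE => /predU1P[->|bs]; [apply: ltW | apply: mlb].
Qed.

Lemma finite_set_max (R : realType) (A : set R) :
  finite_set A -> A !=set0 -> exists M, is_max A M.
Proof.
move=> finA [a Aa].
have [||m [[b Ab <-] mlb]] := @finite_set_min R (-%R @` A).
- exact: finite_image.
- by exists (- a), a.
- exists b; split=> // c Ac; rewrite -lerN2; apply: mlb.
  by exists c.
Qed.

Lemma finite_range_sum (R : realType) (T I : Type) (r : seq I) (P : pred I)
    (f : I -> T -> R) :
  (forall i, finite_set (range (f i))) ->
  finite_set (range (fun w => \sum_(i <- r | P i) f i w)).
Proof.
move=> finf; elim: r => [|i r IHr].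
  by apply: sub_finite_set (finite_set1 (0 : R)) => _ [w _ <-]; rewrite big_nil.
have [Pi|Pi] := boolP (P i); last first.
  by under eq_fun do rewrite big_cons (negbTE Pi).
under eq_fun do rewrite big_cons Pi.
exact: (finite_image11 +%R).
Qed.

Lemma finite_range_indic (R : realType) (T : Type) (A : set T) :
  finite_set (range (\1_A : T -> R)).
Proof. exact: sub_finite_set (@image_indic_sub _ _ _ _) (finite_set2 _ _). Qed.

(** The value of a conjunction at a point depends only on which conjuncts are
false and which are void there. *)
Lemma finite_range_conjunction (R : realType) (Omega : Type) (I : finType)
    (E H : I -> set Omega) (x : {set I} -> R) (S : {set I}) :
  finite_set (range (conjunction E H x S)).
Proof.
pose h w := ([exists i in S, w \in ~` E i `&` H i], void_set H S w).
pose g (bV : bool * {set I}) : R :=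
  if bV.1 then 0 else if bV.2 == finset.set0 then 1 else x bV.2.
apply: (@sub_finite_set _ _ (range g)); last exact: finite_image.
by move=> _ [w _ <-]; exists (h w).
Qed.

Section Coherence.
Variables (R : realType) (Omega : Type) (I : finType) (F : {set I}).
Variables (X : I -> Omega -> R) (K : I -> set Omega) (mu : I -> R).

Lemma coherent_gain_ge0 (J : {set I}) (s : I -> R) :
  coherent F X K mu -> J \subset F -> J != finset.set0 ->
  exists2 w, (\bigcup_(j in [set` J]) K j) w & 0 <= gain J X K mu s w.
Proof.
move=> coh JF J0.
have [m [M [_ [[w Kw <-] _] /andP[_ M_ge0]]]] := coh J s JF J0.
by exists w.
Qed.

(** A point where each bet is void or has its prevision as outcome makes the
gain 0, whatever the stakes, so 0 lies between the extrema of the gain. *)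
Lemma fair_point_coherent :
  (forall j, finite_set (range (X j))) ->
  (forall J : {set I}, J \subset F -> J != finset.set0 ->
     exists2 w, (\bigcup_(j in [set` J]) K j) w
              & forall j, j \in J -> K j w -> X j w = mu j) ->
  coherent F X K mu.
Proof.
move=> finX fair J s JF J0 /=; set G := _ @` _.
have [w Kw Xw] := fair J JF J0.
have G0 : G 0.
  exists w => //; rewrite /gain big1 // => j jJ.
  have [/set_mem Kjw|/negbTE nKjw] := boolP (w \in K j).
    by rewrite Xw // subrr mulr0.
  by rewrite indicE nKjw mulr0 mul0r.
have finG : finite_set G.
  apply: (@sub_finite_set _ _ (range (gain J X K mu s))).
    by move=> _ [v _ <-]; exists v.
  apply: finite_range_sum => j.
  under eq_fun do rewrite -mulrA.
  apply: (finite_image11 (fun a b => s j * (a * (b - mu j)))) => //.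
  exact: finite_range_indic.
have [m minG] := finite_set_min finG (ex_intro _ _ G0).
have [M maxG] := finite_set_max finG (ex_intro _ _ G0).
exists m, M; split=> //; apply/andP.
by split; [apply: minG.2 | apply: maxG.2].
Qed.

End Coherence.

(** * The quasi conjunction and the values of a conjunction *)

Section ConditionalEvents.
Variables (R : realType) (Omega : Type) (I : finType).
Implicit Types (E H : I -> set Omega) (x : {set I} -> R) (S T V : {set I}).

(** [H i w -> E i w] is the material conditional: [E i | H i] is true or void
at [w]. *)
Definition none_false E H S (w : Omega) : Prop :=
  forall i, i \in S -> H i w -> E i w.

(** The event that the quasi conjunction of the [E i | H i], [i] in [S], is
true: none is false and not all are void. *)
Definition quasi_conj E H S : set Omega :=
  (\bigcup_(i in [set` S]) H i) `&` [set w | none_false E H S w].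

Definition negate_at (k : I) E (i : I) : set Omega :=
  if i == k then ~` E i else E i.

(** The empty conjunction is given prevision 1, the value [conjunction] takes
on the empty set.  Inductions on the set of conjuncts can then start from the
empty set, and a conclusion that is never false is implied by the empty set of
premises. *)
Definition prevision x S : R := if S == finset.set0 then 1 else x S.

Lemma none_false_sub E H S T w :
  S \subset T -> none_false E H T w -> none_false E H S w.
Proof. by move=> /fintype.subsetP ST nT i iS; apply/nT/ST. Qed.

Lemma none_false_negate_at E H k S w :
  k \notin S -> none_false (negate_at k E) H S w <-> none_false E H S w.
Proof.
by move=> kS; split=> nS i iS Hi; have := nS i iS Hi;
  rewrite /negate_at; case: eqP iS kS => // -> ->.
Qed.

Lemma conjunction_none_false E H x S w : none_false E H S w ->
  conjunction E H x S w = prevision x (void_set H S w).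
Proof.
rewrite /conjunction => nS; case: ifP => // /fintype.existsP[i /andP[iS]].
by move=> /set_mem[nEi Hi]; case: nEi; apply: nS.
Qed.

Lemma conjunction_some_false E H x S w : ~ none_false E H S w ->
  conjunction E H x S w = 0.
Proof.
rewrite /conjunction => nS; case: ifP => // /negbT/negP exF.
case: nS => i iS Hi.
apply: contrapT => nEi; apply: exF; apply/fintype.existsP; exists i.
by rewrite iS; apply/mem_set.
Qed.

Lemma in_void_set H S w i :
  (i \in void_set H S w) = (i \in S) && (w \notin H i).
Proof. by rewrite inE. Qed.

Lemma void_set_sub H S w : void_set H S w \subset S.
Proof. by apply/fintype.subsetP => i; rewrite in_void_set => /andP[]. Qed.

Lemma void_set_proper H S w : (\bigcup_(i in [set` S]) H i) w ->
  void_set H S w \proper S.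
Proof.
move=> [i /= iS Hi]; apply/properP; split; first exact: void_set_sub.
by exists i => //; rewrite in_void_set iS (mem_set Hi).
Qed.

Lemma void_set_id H S w : ~ (\bigcup_(i in [set` S]) H i) w ->
  void_set H S w = S.
Proof.
move=> nS; apply/setP => i; rewrite in_void_set andb_idr // => iS.
by apply/negP => /set_mem Hi; apply: nS; exists i.
Qed.

Lemma void_setS H S T w : S \subset T -> void_set H S w \subset void_set H T w.
Proof.
move=> /fintype.subsetP ST; apply/fintype.subsetP => i; rewrite !in_void_set.
by move=> /andP[/ST -> ->].
Qed.

(** A conjunction that is called off is worth its prevision, so that a bet on
it has zero outcome without the indicator of its conditioning event. *)
Lemma conjunction_void E H x S w : ~ (\bigcup_(i in [set` S]) H i) w ->
  conjunction E H x S w = prevision x S.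
Proof.
move=> nS; rewrite conjunction_none_false ?void_set_id // => i iS Hi.
by case: nS; exists i.
Qed.

Lemma conjunction1 E H x k w :
  conjunction E H x [set k]%SET w = cond_event (E k) (H k) (x [set k]%SET) w.
Proof.
rewrite /cond_event !indicE in_setI in_setC.
have [/set_mem Hk|nHk] := boolP (w \in H k); last first.
  rewrite conjunction_void; last first.
    by move=> [i /=]; rewrite inE => /eqP -> /mem_set; rewrite (negbTE nHk).
  rewrite /prevision ifN ?andbF ?add0r ?mulr1 //.
  by apply/set0Pn; exists k; rewrite inE.
rewrite andbT mulr0 addr0; have [/set_mem Ek|nEk] := boolP (w \in E k).
- rewrite conjunction_none_false; last by move=> i; rewrite inE => /eqP ->.
  rewrite /prevision ifT //; apply/set0Pn => -[i]; rewrite in_void_set inE.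
  by case/andP=> /eqP ->; rewrite (mem_set Hk).
- rewrite conjunction_some_false // => /(_ k); rewrite inE eqxx => /(_ isT Hk).
  by move/mem_set; rewrite (negbTE nEk).
Qed.

(** * Coherent previsions of conjunctions *)

(** A bet on two conjunctions, one over a subset of the other, is called off
only where the larger one is void.  Taking [B] empty gives the bets on a single
conjunction. *)
Lemma coherent_conj_bet E H x (A B : {set I}) (s t : R) :
  coherent_conj E H x -> B \proper A ->
  exists2 w, (\bigcup_(i in [set` A]) H i) w &
    0 <= s * (conjunction E H x A w - prevision x A)
       + t * (conjunction E H x B w - prevision x B).
Proof.
move=> coh /properP[BA [a aA aB]].
have A0 : A != finset.set0 by apply/set0Pn; exists a.
have [-> |B0] := eqVneq B finset.set0.
  have [||w] := coherent_gain_ge0 (J := [set A]%SET) (fun=> s) coh.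
  - by rewrite finset.sub1set inE.
  - by apply/set0Pn; exists A; rewrite inE.
  move=> [S /=]; rewrite inE => /eqP -> HA; rewrite /gain big_set1.
  rewrite indicE (mem_set HA) mulr1 => G_ge0; exists w => //.
  rewrite [conjunction E H x finset.set0 w]conjunction_void.
    by rewrite subrr mulr0 addr0 /prevision (negbTE A0).
  by move=> [i /=]; rewrite inE.
have AB : A != B by apply: contraNneq aB => <-.
have [||w Kw] :=
  coherent_gain_ge0 (J := [set A; B]%SET) (fun S => if S == A then s else t) coh.
- by apply/fintype.subsetP => S; rewrite !inE => /orP[] /eqP ->.
- by apply/set0Pn; exists A; rewrite !inE eqxx.
have KA : (\bigcup_(i in [set` A]) H i) w.
  move: Kw => [S /=]; rewrite !inE => /orP[] /eqP -> // [i /= iB Hi].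
  by exists i => //=; apply: (fintype.subsetP BA).
rewrite /gain big_setU1 ?inE //= big_set1 eqxx eq_sym (negbTE AB).
rewrite !indicE (mem_set KA) mulr1 /= => G_ge0; exists w => //.
rewrite /prevision (negbTE A0) (negbTE B0).
apply: le_trans G_ge0 _; rewrite lerD2l.
have [_|nKB] := boolP (w \in _); first by rewrite mulr1.
rewrite mulr0 mul0r [conjunction E H x B w]conjunction_void.
  by rewrite /prevision (negbTE B0) subrr mulr0.
by move/mem_set; rewrite (negbTE nKB).
Qed.

(** A bet against the conjunction cannot be a sure loss, and where it is not
called off the conjunction takes the value 0, or the prevision of a smaller
conjunction. *)
Lemma prevision_ge0 E H x S : coherent_conj E H x -> 0 <= prevision x S.
Proof.
move=> coh; elim/ltn_ind: {S}#|S| {-2}S (erefl #|S|) => n IHn S Sn.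
have [->|S0] := eqVneq S finset.set0; first by rewrite /prevision eqxx.
have [|w KS] := coherent_conj_bet (-1) 0 coh (B := finset.set0) (A := S).
  by rewrite proper0.
rewrite mul0r addr0 mulN1r opprB subr_ge0 => /(le_trans _); apply.
have [nS|nS] := pselect (none_false E H S w); last first.
  by rewrite conjunction_some_false.
rewrite conjunction_none_false //; apply: IHn erefl.
by rewrite -Sn; apply/proper_card/void_set_proper.
Qed.

Lemma conjunction_ge0 E H x S w : coherent_conj E H x ->
  0 <= conjunction E H x S w.
Proof.
move=> coh; have [nS|nS] := pselect (none_false E H S w).
  by rewrite conjunction_none_false // (prevision_ge0 _ coh).
by rewrite conjunction_some_false.
Qed.

Lemma le_conjunction_prevision E H x (A B : {set I}) w :
  coherent_conj E H x -> B \subset A ->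
  prevision x (void_set H A w) <= prevision x (void_set H B w) ->
  conjunction E H x A w <= conjunction E H x B w.
Proof.
move=> coh BA le_void; have [nA|nA] := pselect (none_false E H A w).
  by rewrite !conjunction_none_false //; apply: none_false_sub nA.
by rewrite conjunction_some_false // conjunction_ge0.
Qed.

(** Bet on the conjunction over [A] and against the one over [B]: where the
bet is not called off, the void part of [A] is a proper subset of [A], and by
induction the outcome of the first does not exceed that of the second. *)
Lemma prevision_anti E H x (A B : {set I}) :
  coherent_conj E H x -> B \subset A -> prevision x A <= prevision x B.
Proof.
move=> coh; elim/ltn_ind: {A}#|A| {-2}A (erefl #|A|) B => n IHn A An B BA.
have [-> //|BneA] := eqVneq B A.
have {}BneA : B \proper A by rewrite finset.properEneq BneA.
have [w KA bet] := coherent_conj_bet 1 (-1) coh BneA.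
suff : conjunction E H x A w <= conjunction E H x B w by lra.
apply: le_conjunction_prevision => //; apply: IHn (erefl) _ (void_setS _ _ BA).
by rewrite -An; apply/proper_card/void_set_proper.
Qed.

Lemma conjunction_anti E H x (A B : {set I}) w :
  coherent_conj E H x -> B \subset A ->
  conjunction E H x A w <= conjunction E H x B w.
Proof.
move=> coh BA; apply: le_conjunction_prevision => //.
exact: prevision_anti coh (void_setS _ _ BA).
Qed.

(** * Consequences of a quasi conjunction that is never true *)

Lemma coherent_prob_le1 E H (F : {set I}) (p : I -> R) i :
  coherent_prob F E H p -> i \in F -> p i <= 1.
Proof.
move=> coh iF.
have [||w] := coherent_gain_ge0 (J := [set i]%SET) (fun=> 1) coh.
- by rewrite finset.sub1set.
- by apply/set0Pn; exists i; rewrite inE.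
move=> [j /=]; rewrite inE => /eqP -> Hi; rewrite /gain big_set1.
rewrite !indicE (mem_set Hi) mulr1 mul1r subr_ge0 => /le_trans; apply.
by case: (w \in E i); rewrite ?ler01.
Qed.

Section QuasiConjunctionEmpty.
Variables (E H : I -> set Omega) (k : I) (S : {set I}).
Hypothesis kS : k \notin S.
Hypothesis qc0 : quasi_conj (negate_at k E) H (k |: S)%SET = set0.

(** The form in which the emptiness hypothesis is used: where no premise of
[S] is false, the conclusion is true unless [k] and all of [S] are void. *)
Lemma quasi_conj_implies w : none_false E H S w ->
  (\bigcup_(i in [set` (k |: S)%SET]) H i) w -> H k w /\ E k w.
Proof.
move=> nS KkS; apply: contrapT => nk.
suff : quasi_conj (negate_at k E) H (k |: S)%SET w by rewrite qc0.
split=> // i /setU1P[-> Hk|iS Hi]; rewrite /negate_at ?eqxx.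
  by move=> Ek; apply: nk.
by case: eqP iS => [->|_ iS]; [rewrite (negbTE kS) | apply: nS].
Qed.

(** The two conjunctions agree wherever some conjunct in [V] is false or [k]
is true; by [quasi_conj_implies] there remain only the points where [k] and all
of [S] are void, and the hypothesis deals with these. *)
Lemma conjunction_absorbs x V w : S \subset V ->
  (w \notin H k -> S \subset void_set H V w ->
     prevision x (k |: void_set H V w)%SET = prevision x (void_set H V w)) ->
  conjunction E H x (k |: V)%SET w = conjunction E H x V w.
Proof.
move=> SV eq_void.
have [nV|nV] := pselect (none_false E H V w); last first.
  rewrite !conjunction_some_false // => nkV; apply: nV.
  exact: none_false_sub (finset.subsetUr _ _) nkV.
have nS : none_false E H S w by apply: none_false_sub nV.
have nkV : none_false E H (k |: V)%SET w.
  move=> i /setU1P[-> Hk|]; last exact: nV.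
  by have [] := quasi_conj_implies nS; first by exists k => //=; rewrite setU11.
rewrite !conjunction_none_false //.
have [Hk|nHk] := boolP (w \in H k).
  congr prevision; apply/setP => i; rewrite !in_void_set !inE andb_orl.
  by case: eqP => [->|]; rewrite ?Hk.
have -> : void_set H (k |: V)%SET w = (k |: void_set H V w)%SET.
  apply/setP => i; rewrite !in_void_set !inE andb_orl.
  by case: eqP => [->|]; rewrite ?nHk ?andbF.
apply: eq_void => //; apply/fintype.subsetP => i iS.
rewrite in_void_set (fintype.subsetP SV) //=; apply/negP => /set_mem Hi.
have [|Hk _] := quasi_conj_implies nS; first by exists i => //=; rewrite setU1r.
by rewrite (mem_set Hk) in nHk.
Qed.

(** The bet on [k |: V] and against [V] has the constant gain
[prevision x V - prevision x (k |: V)] where it is not called off, so coherence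
makes this constant 0.  At the points that [conjunction_absorbs] leaves open,
the void part of [V] still contains [S] but is smaller than [V], because some
conjunct of [k |: V] is not void and [k] is. *)
Lemma prevision_absorbs x V : coherent_conj E H x -> k \notin V -> S \subset V ->
  prevision x (k |: V)%SET = prevision x V.
Proof.
move=> coh; elim/ltn_ind: {V}#|V| {-2}V (erefl #|V|) => n IHn V Vn kV SV.
have pV : V \proper (k |: V)%SET by apply/properUr; rewrite finset.sub1set.
have eqC w : (\bigcup_(i in [set` (k |: V)%SET]) H i) w ->
    conjunction E H x (k |: V)%SET w = conjunction E H x V w.
  move=> [i /= ikV Hi]; apply: conjunction_absorbs => // nHk Svoid.
  apply: (IHn _ _ _ erefl) => //; last first.
    by apply: contra kV => /(fintype.subsetP (void_set_sub _ _ _)).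
  rewrite -Vn; apply/proper_card/void_set_proper; exists i => //=.
  by case/setU1P: ikV Hi => // -> /mem_set; rewrite (negbTE nHk).
(* Both signs of the constant gain are excluded, one bet for each. *)
have [w1 /eqC eq1 bet1] := coherent_conj_bet 1 (-1) coh pV.
have [w2 /eqC eq2 bet2] := coherent_conj_bet (-1) 1 coh pV.
by lra.
Qed.

Lemma quasi_conj_empty_conjunction x V w :
  coherent_conj E H x -> k \notin V -> S \subset V ->
  conjunction E H x (k |: V)%SET w = conjunction E H x V w.
Proof.
move=> coh kV SV; apply: conjunction_absorbs => // _ Svoid.
apply: prevision_absorbs => //.
by apply: contra kV => /(fintype.subsetP (void_set_sub _ _ _)).
Qed.

(** The stakes are 1 on each premise of [S] and -1 on the conclusion.  If no
premise of [S] is false the conclusion is true and the gain is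
[p k - 1]; otherwise a false premise loses 1, and the bet against the conclusion
wins at most [p k].  Both are negative when [p k < 1]. *)
Lemma quasi_conj_empty_entails (F : {set I}) : S \subset F -> p_entails R F k E H.
Proof.
move=> SF p coh pF; have kkF : k \in (k |: F)%SET by rewrite setU11.
have pk_le1 := coherent_prob_le1 coh kkF.
apply/eqP; rewrite eq_le pk_le1 leNgt; apply/negP => pk_lt1.
have [||w KkS] := coherent_gain_ge0 (J := (k |: S)%SET)
  (fun i => if i == k then -1 else 1) coh.
- exact: finset.setUS.
- by apply/set0Pn; exists k; rewrite setU11.
rewrite /gain big_setU1 //= eqxx.
(* With premises of probability 1, the stakes on [S] lose 1 per false premise. *)
have -> : \sum_(i in S) (if i == k then -1 else 1)
      * \1_(H i) w * (\1_(E i) w - p i)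
    = - \sum_(i in S) ((w \in H i) && (w \notin E i))%:R.
  rewrite -sumrN; apply: eq_bigr => i iS.
  rewrite ifN; last by apply: contraNneq kS => <-.
  rewrite pF ?(fintype.subsetP SF) // !indicE mul1r.
  by case: (w \in H i); case: (w \in E i); rewrite ?subrr ?sub0r ?mulr0 ?mul0r
    ?mul1r ?oppr0.
have [nS|nS] := pselect (none_false E H S w).
  have [Hk Ek] := quasi_conj_implies nS KkS.
  rewrite big1 => [|i iS].
    by rewrite !indicE (mem_set Hk) (mem_set Ek) /=; lra.
  have [/set_mem Hi|//] := boolP (w \in H i).
  by rewrite (mem_set (nS i iS Hi)).
(* One false premise already costs 1; the other premises never win. *)
have [i iS [Hi nEi]] : exists2 i, i \in S & H i w /\ ~ E i w.
  apply: contrapT => nex; apply: nS => i iS Hi; apply: contrapT => nEi.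
  by apply: nex; exists i.
rewrite (big_setD1 i iS) /= (mem_set Hi).
rewrite (_ : w \notin E i); last by apply/negP => /set_mem.
have := @sumr_ge0 R I (index_enum I) (fun j => j \in (S :\ i)%SET)
  (fun j => ((w \in H j) && (w \notin E j))%:R) (fun j _ => ler0n _ _).
set rest := \sum_(_ | _) _ => rest_ge0.
by rewrite !indicE; case: (w \in H k); case: (w \in E k) => /=; lra.
Qed.

End QuasiConjunctionEmpty.

(** * Counterexamples when no quasi conjunction is empty *)

Section QuasiConjunctionNonempty.
Variables (E H : I -> set Omega) (k : I) (F : {set I}).
Hypothesis F_cons : p_consistent R F E H.
Hypothesis kF : k \notin F.
Hypothesis qcN0 : forall S, S \subset F ->
  quasi_conj (negate_at k E) H (k |: S)%SET !=set0.

(** With unit stakes at probability 1 the gain is minus the number of false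
conditional events, and coherence makes it nonnegative somewhere. *)
Lemma p_consistent_quasi_conj S : S \subset F -> S != finset.set0 ->
  quasi_conj E H S !=set0.
Proof.
move=> SF S0; have [w KS] := coherent_gain_ge0 (fun=> 1) F_cons SF S0.
move=> G_ge0; exists w; split=> // i iS Hi; apply: contrapT => nEi.
move: G_ge0; rewrite leNgt => /negP; apply.
rewrite /gain (big_setD1 i iS) /= !indicE (mem_set Hi).
rewrite (_ : (w \in E i) = false); last by apply/negP => /set_mem.
rewrite !mul1r sub0r; apply: (@le_lt_trans _ _ (-1)); last by rewrite ltrN10.
rewrite gerDl; apply: sumr_le0 => j _; rewrite !indicE.
by case: (w \in H j); case: (w \in E j) => /=; lra.
Qed.

Lemma negate_at_quasi_conj S : S \subset (k |: F)%SET -> S != finset.set0 ->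
  quasi_conj (negate_at k E) H S !=set0.
Proof.
move=> SkF S0; have [kS|kS] := boolP (k \in S).
  by rewrite -(finset.setD1K kS); apply: qcN0; rewrite finset.subDset.
have SF : S \subset F.
  apply/fintype.subsetP => i iS; have := fintype.subsetP SkF i iS.
  by case/setU1P => // ik; rewrite -ik iS in kS.
have [w [KS nS]] := p_consistent_quasi_conj SF S0.
by exists w; split=> //; apply/none_false_negate_at.
Qed.

(** Probability 1 for the premises and 0 for the conclusion is coherent: a
point where a quasi conjunction of the family with negated conclusion is true
is fair for the corresponding bets. *)
Lemma quasi_conj_nonempty_not_entails : ~ p_entails R F k E H.
Proof.
move=> /(_ (fun i => (i != k)%:R)) ent.
suff /ent : coherent_prob (k |: F)%SET E H (fun i => (i != k)%:R : R).
  rewrite eqxx => /(_ _)/eqP.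
  rewrite eq_sym oner_eq0 => absurd.
  suff : false by []; apply: absurd => i iF.
  by rewrite (_ : i != k) //; apply: contraNneq kF => <-.
apply: fair_point_coherent => [j|J JkF J0]; first exact: finite_range_indic.
have [w [KJ nJ]] := negate_at_quasi_conj JkF J0; exists w => // j jJ Hj.
have := nJ j jJ Hj; rewrite /negate_at indicE; case: eqP => _ Ej.
  by rewrite (_ : (w \in E j) = false) //; apply/negP => /set_mem.
by rewrite (mem_set Ej).
Qed.

(** The previsions that make the premises certain and give the conclusion
probability 0, extended to all conjunctions. *)
Let x0 S : R := (k \notin S)%:R.

(** A conjunction involving [k] vanishes at such a point if [k] is not void,
since the conclusion is then false; if [k] is void it stays in the void part,
whose prevision is again 0. *)
Lemma conjunction_negate_at S w : none_false (negate_at k E) H S w ->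
  conjunction E H x0 S w = x0 S.
Proof.
move=> nS; rewrite /x0; have [kS|kS] := boolP (k \in S); last first.
  rewrite conjunction_none_false; last by apply/(none_false_negate_at _ _ _ kS).
  rewrite /prevision /x0; case: ifP => // _.
  by rewrite (contra (fintype.subsetP (void_set_sub H S w) k) kS).
have [/set_mem Hk|nHk] := boolP (w \in H k).
  rewrite conjunction_some_false // => /(_ k kS Hk) Ek.
  by have := nS k kS Hk; rewrite /negate_at eqxx.
have k_void : k \in void_set H S w by rewrite in_void_set kS.
rewrite conjunction_none_false => [|i iS Hi].
  rewrite /prevision /x0 k_void ifN //; apply/set0Pn; by exists k.
have := nS i iS Hi; rewrite /negate_at; case: eqP => // ik.
by move: Hi; rewrite ik => /mem_set; rewrite (negbTE nHk).
Qed.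

(** For bets on the conjunctions over the sets [S] in [J], the fair point is
one where the quasi conjunction over the union of [J] is true.  Where the one
over [k |: F] is true, the conjunction of the premises is 1 and the conclusion
is 0. *)
Lemma quasi_conj_nonempty_counterexample : (k |: F)%SET = [set: I]%SET ->
  exists2 x : {set I} -> R, coherent_conj E H x &
    exists w, conjunction E H x [set k]%SET w < conjunction E H x F w.
Proof.
move=> kFT; exists x0.
  apply: fair_point_coherent => [S|J /fintype.subsetP JN0 /set0Pn[S0 S0J]].
    exact: finite_range_conjunction.
  have S00 : S0 != finset.set0 by have := JN0 _ S0J; rewrite inE.
  have [|| w [[i /= /finset.bigcupP[S SJ iS] Hi] nU]] :=
    @negate_at_quasi_conj (\bigcup_(S in J) S)%SET.
  - by rewrite kFT finset.subsetT.
  - have /set0Pn[i iS0] := S00.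
    by apply/set0Pn; exists i; apply/finset.bigcupP; exists S0.
  exists w => [|T TJ _]; first by exists S => //; exists i.
  by apply/conjunction_negate_at/(none_false_sub _ nU)/finset.bigcup_sup.
have [w [_ nkF]] := qcN0 (fintype.subxx F); exists w.
rewrite !conjunction_negate_at /x0 ?kF ?inE ?eqxx ?ltr01 //.
  by apply: none_false_sub nkF; apply: finset.subsetUr.
by apply: none_false_sub nkF; apply: finset.subsetUl.
Qed.

End QuasiConjunctionNonempty.
End ConditionalEvents.

(** * The equivalence *)

(** The conclusion is indexed by [ord_max], the premises by the other indices. *)
Theorem theorem18 (R : realType) (Omega : Type) (n : nat) (n_gt0 : (0 < n)%N)
    (E H : 'I_n.+1 -> set Omega) (H_neq0 : forall i, H i !=set0)
    (F_cons : p_consistent R [set~ ord_max]%SET E H) :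
  (p_entails R [set~ ord_max]%SET ord_max E H <->
   (forall x : {set 'I_n.+1} -> R, coherent_conj E H x ->
      forall w : Omega, conjunction E H x [set: 'I_n.+1]%SET w
                      = conjunction E H x [set~ ord_max]%SET w)) /\
  (p_entails R [set~ ord_max]%SET ord_max E H <->
   (forall x : {set 'I_n.+1} -> R, coherent_conj E H x ->
      forall w : Omega, conjunction E H x [set~ ord_max]%SET w
        <= cond_event (E ord_max) (H ord_max) (x [set ord_max]%SET) w)).
Proof.
set F := [set~ ord_max]%SET; set k : 'I_n.+1 := ord_max.
have kF : k \notin F by rewrite !inE eqxx.
have kFT : (k |: F)%SET = [set: 'I_n.+1]%SET by rewrite finset.setUCr.
pose qc_empty := exists2 S : {set 'I_n.+1}, S \subset F &
  quasi_conj (negate_at k E) H (k |: S)%SET = set0.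
have dichotomy : ~ qc_empty ->
    forall S : {set 'I_n.+1}, S \subset F ->
      quasi_conj (negate_at k E) H (k |: S)%SET !=set0.
  move=> nqc S SF; apply: contrapT => qcS; apply: nqc; exists S => //.
  by apply/eqP; apply: contrapT => /negP/set0P.
have entailsP : p_entails R F k E H -> qc_empty.
  move=> ent; apply: contrapT => /dichotomy qcN0.
  exact: quasi_conj_nonempty_not_entails F_cons kF qcN0 ent.
have absorbs : qc_empty -> forall x : {set 'I_n.+1} -> R, coherent_conj E H x ->
    forall w, conjunction E H x [set: 'I_n.+1]%SET w = conjunction E H x F w.
  move=> [S SF qc0] x coh w; rewrite -kFT.
  apply: (quasi_conj_empty_conjunction _ qc0) => //.
  by apply: contra kF; apply: (fintype.subsetP SF).
have bound : (forall x : {set 'I_n.+1} -> R, coherent_conj E H x ->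
    forall w, conjunction E H x F w
      <= cond_event (E k) (H k) (x [set k]%SET) w) -> p_entails R F k E H.
  move=> leC; have [S SF qc0] : qc_empty.
    apply: contrapT => /dichotomy qcN0.
    have [x coh [w]] := quasi_conj_nonempty_counterexample F_cons kF qcN0 kFT.
    by rewrite conjunction1 ltNge (leC x coh w).
  apply: (quasi_conj_empty_entails _ qc0) => //.
  by apply: contra kF; apply: (fintype.subsetP SF).
have eq_le : (forall x : {set 'I_n.+1} -> R, coherent_conj E H x ->
    forall w, conjunction E H x [set: 'I_n.+1]%SET w = conjunction E H x F w) ->
  forall x : {set 'I_n.+1} -> R, coherent_conj E H x ->
    forall w, conjunction E H x F w <= cond_event (E k) (H k) (x [set k]%SET) w.
  move=> eqC x coh w; rewrite -eqC // -conjunction1.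
  exact: conjunction_anti coh (finset.subsetT _).
split; split.
- by move=> /entailsP; apply: absorbs.
- by move=> /eq_le; apply: bound.
- by move=> /entailsP qc; apply/eq_le/absorbs.
- exact: bound.
Qed.
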